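(* Let $m, n, r \in \mathbb{N}$ with $r \leq m \leq n$. Then $$a^{\mathbb{R}}(m \times n;r) = rn - \frac{r(r+1)}{2}.$$
   Context: $\mathbb{N}$ includes $0$. $M(m\times n,\mathbb{R})$ denotes the real vector space of $m\times n$ real matrices. An affine subspace $S$ of $M(m\times n,\mathbb{R})$ is a set of the form $A+W$ with $A \in M(m\times n,\mathbb{R})$ and $W$ a linear subspace of $M(m\times n,\mathbb{R})$; its dimension is $\dim W$. $S$ has constant rank $r$ if every matrix of $S$ has rank $r$. $a^{\mathbb{R}}(m\times n;r)$ denotes the maximum of $\dim S$ over all affine subspaces $S$ of $M(m\times n,\mathbb{R})$ of constant rank $r$. *)

(* Defs.v *)
From mathcomp Require Import all_boot all_order all_algebra.
From mathcomp Require Import boolp classical_sets reals.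

Set Implicit Arguments.
Unset Strict Implicit.
Unset Printing Implicit Defensive.

Import Order.TTheory GRing.Theory Num.Theory.

Local Open Scope classical_set_scope.
Local Open Scope ring_scope.

(* The direction W is determined by S, so at most one d satisfies this. *)
Definition affine_subspace_of_dim (R : realType) (m n : nat)
    (S : set 'M[R]_(m, n)) (d : nat) : Prop :=
  exists (A : 'M[R]_(m, n)) (W : {vspace 'M[R]_(m, n)}),
    S = [set A + B | B in [set` W]] /\ d = \dim W.

Definition constant_rank (R : realType) (m n : nat)
    (S : set 'M[R]_(m, n)) (r : nat) : Prop :=
  forall B : 'M[R]_(m, n), S B -> \rank B = r.

Definition constant_rank_dims (R : realType) (m n r : nat) : set nat :=
  [set d | exists S : set 'M[R]_(m, n),
     affine_subspace_of_dim S d /\ constant_rank S r].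

Definition is_maximum (D : set nat) (k : nat) : Prop :=
  D k /\ (forall d : nat, D d -> (d <= k)%N).

(* The equation a(m x n; r) = k, stated relationally so that it includes the
   existence of the maximum. *)
Definition max_affine_dim_constant_rank (R : realType) (m n r k : nat) : Prop :=
  is_maximum (constant_rank_dims R m n r) k.

(* Main.v *)
From HB Require Import structures.
Require Import Defs.
From mathcomp Require Import all_boot all_order all_algebra.
From mathcomp Require Import boolp classical_sets reals.
From mathcomp Require Import spectral complex zify ring.

Set Implicit Arguments.
Unset Strict Implicit.
Unset Printing Implicit Defensive.

Import Order.TTheory GRing.Theory Num.Theory.
Local Open Scope ring_scope.

(** Let [S = A + W] have constant rank [r]. Multiplying by invertible matrices
    on both sides, one may take [A = pid_mx r], the identity of size [r] padded
    with zeros. Write the matrices of [W] as blocks [X Y; Z V] with [X] of size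
    [r x r].

    Upper bound. The number [r n - r (r + 1) / 2] counts the positions [(i, j)]
    with [i < r] and [i < j], so it is enough to find an injective linear map
    from [W] to the functions on these positions. It is [sym_defect]: at [(i, j)]
    it takes the value [B i j - B j i], where [B j i] counts as [0] when [j] is
    not a row index. Let [B] be in its kernel: [X] is symmetric and
    [Y = (Z^T, 0)]. Every [A + t B] has rank at most [r], so the minors that
    border the leading [r x r] block vanish; as polynomials in [t] they vanish
    identically, and their terms of lowest degree in [t] are, up to sign, the
    entries of [V] and then those of [Z Y] ([rank_pencil_corner]). Hence [V = 0]
    and [Z Z^T = 0], and over a real field this gives [Z = 0], so [Y = 0]. Now
    the rank is also at least [r], so [1 + t X] is invertible for every real
    [t]: the real symmetric matrix [X] has no nonzero eigenvalue, and the
    spectral theorem gives [X = 0] ([symmetric_pencil_unit_eq0]). Thus [B = 0].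

    Lower bound. Adding to [pid_mx r] arbitrary entries at those same positions
    keeps a matrix in echelon form with [r] unit pivots. *)

(** * Bordered minors of a pencil *)

Lemma poly_vanishing_off0 (F : numFieldType) (q : {poly F}) :
  (forall t, t != 0 -> q.[t] = 0) -> q = 0.
Proof.
move=> q0; pose s := [seq i.+1%:R : F | i <- iota 0 (size q)].
apply: (@roots_geq_poly_eq0 _ q s).
- apply/allP => _ /mapP[i _ ->]; apply/rootP/q0.
  by rewrite pnatr_eq0.
- rewrite map_inj_uniq ?iota_uniq // => i j /eqP.
  by rewrite eqr_nat => /eqP[].
- by rewrite size_map size_iota.
Qed.

(** A determinant is a polynomial in the parameter of the pencil, so it cannot
    vanish at every nonzero parameter without vanishing at [0]. This replaces
    taking a limit [t -> 0]. *)
Lemma det_pencil_at0 (F : numFieldType) n (M0 M1 : 'M[F]_n) :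
  (forall t, t != 0 -> \det (M0 + t *: M1) = 0) -> \det M0 = 0.
Proof.
move=> det0.
pose Q := map_mx polyC M0 + 'X *: map_mx polyC M1.
have evalQ t : (\det Q).[t] = \det (M0 + t *: M1).
  rewrite -horner_evalE -det_map_mx; congr (\det _).
  by apply/matrixP => i j; rewrite !mxE /= /horner_eval !hornerE.
have Q0 : \det Q = 0.
  by apply: poly_vanishing_off0 => t /det0; rewrite evalQ.
by have := evalQ 0; rewrite Q0 horner0 scale0r addr0.
Qed.

Lemma bordered_minor_eq0 (F : fieldType) r p s (A : 'M[F]_r)
    (B : 'M[F]_(r, s)) (C : 'M[F]_(p, r)) (D : 'M[F]_(p, s)) i j :
  (\rank (block_mx A B C D) <= r)%N ->
  \det (block_mx A (col j B) (row i C) (D i j)%:M) = 0.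
Proof.
move=> rk; set N := block_mx A (col _ _) _ _.
have defN : N = block_mx 1%:M 0 0 (delta_mx (0 : 'I_1) i) *m
    block_mx A B C D *m block_mx 1%:M 0 0 (delta_mx j (0 : 'I_1)).
  rewrite !mulmx_block !(mul0mx, mulmx0, mul1mx, mulmx1, addr0, add0r).
  rewrite -!rowE -!colE; congr block_mx.
  by apply/rowP => k; rewrite ord1 !mxE.
apply/eqP; apply: contraTT rk => nz; rewrite -ltnNge.
have /mxrank_unit rkN : N \in unitmx by rewrite unitmxE unitfE.
rewrite -addn1 -{1}rkN defN.
exact: leq_trans (mxrankM_maxl _ _) (mxrankM_maxr _ _).
Qed.

(** If [1 + t X] is invertible, rank at most [r] means that the Schur complement
    [t V - t ^ 2 Z (1 + t X)^-1 Y] is zero; its two lowest coefficients in [t]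
    are [V] and [- Z Y]. Bordered minors express this one entry at a time, with
    no inverse matrix. *)
Lemma rank_pencil_corner (F : numFieldType) r p s (X : 'M[F]_r)
    (Y : 'M[F]_(r, s)) (Z : 'M[F]_(p, r)) (V : 'M[F]_(p, s)) :
  (forall t, \rank (block_mx (1%:M + t *: X) (t *: Y) (t *: Z) (t *: V))%R
               <= r)%N ->
  V = 0 /\ Z *m Y = 0.
Proof.
move=> rk.
(* The last column of the minor is divisible by t; this is the quotient. *)
have minor0 i j t : t != 0 ->
  \det (block_mx (1%:M + t *: X) (col j Y) (t *: row i Z) (V i j)%:M) = 0.
  move=> t0; have := bordered_minor_eq0 i j (rk t).
  have -> : block_mx (1%:M + t *: X) (col j (t *: Y)) (row i (t *: Z))
                ((t *: V) i j)%:M =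
      block_mx (1%:M + t *: X) (col j Y) (t *: row i Z) (V i j)%:M *m
      block_mx 1%:M 0 0 t%:M.
    rewrite mulmx_block !(mulmx0, mulmx1, addr0, add0r) !mul_mx_scalar.
    by rewrite !linearZ /= mxE scale_scalar_mx.
  rewrite det_mulmx det_lblock det1 mul1r det_scalar1 => /eqP.
  by rewrite mulIr_eq0 => [/eqP//|]; apply: mulIf.
have V0 : V = 0.
  apply/matrixP => i j; rewrite [RHS]mxE.
  have := @det_pencil_at0 _ _ (block_mx 1%:M (col j Y) 0 (V i j)%:M)
    (block_mx X 0 (row i Z) 0).
  rewrite det_ublock det1 mul1r det_scalar1; apply => t t0.
  rewrite scale_block_mx add_block_mx !scaler0 !addr0 add0r.
  exact: minor0.
split=> //; apply/matrixP => i j; rewrite [RHS]mxE.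
(* With V = 0 the last row of the minor is divisible by t as well; the value at
   t = 0 of the remaining determinant is computed by this elimination. *)
have schur : block_mx 1%:M 0 (- row i Z) 1%:M *m
    block_mx 1%:M (col j Y) (row i Z) 0 =
    block_mx 1%:M (col j Y) 0 (- (Z *m Y) i j)%:M.
  rewrite mulmx_block !(mul1mx, mulmx1, mul0mx, mulmx0, addr0) addNr.
  congr block_mx; apply/matrixP => k l.
  rewrite !ord1 mulNmx !mxE mulr1n; congr (- _).
  by apply: eq_bigr => q _; rewrite !mxE.
have := congr1 determinant schur.
rewrite det_mulmx det_lblock det_ublock !det1 !mul1r det_scalar1.
rewrite (@det_pencil_at0 _ _ _ (block_mx X 0 0 0)).
  by move/esym/eqP; rewrite oppr_eq0 => /eqP.
move=> t t0; rewrite scale_block_mx add_block_mx !scaler0 !addr0.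
have -> : block_mx (1%:M + t *: X) (col j Y) (row i Z) 0 =
    block_mx 1%:M 0 0 (t^-1)%:M *m
    block_mx (1%:M + t *: X) (col j Y) (t *: row i Z) (V i j)%:M.
  rewrite mulmx_block !(mul1mx, mul0mx, addr0, add0r) mul_scalar_mx scalerA.
  by rewrite mulVf // scale1r V0 mxE raddf0 mulmx0.
by rewrite det_mulmx minor0 // mulr0.
Qed.

(** * Directions whose top rows and left columns agree *)

(** The pencil is singular at [t = - 1 / k] for each nonzero real eigenvalue [k]
    of [S]. A real symmetric matrix is Hermitian over [R[i]], so it is
    diagonalizable with real eigenvalues, and these must all be zero. *)
Lemma symmetric_pencil_unit_eq0 (R : rcfType) n (S : 'M[R]_n) :
  S^T = S -> (forall t, 1%:M + t *: S \in unitmx) -> S = 0.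
Proof.
move=> symS unitS.
pose SC := map_mx (real_complex R) S.
have hermS : SC \is hermsymmx.
  apply: realsym_hermsym.
    by apply/is_hermitianmxP; rewrite expr0 scale1r map_mx_id // map_trmx symS.
  by apply/mxOverP => i j; rewrite mxE complex_real.
have /orthomx_spectralP defSC := hermitian_normalmx hermS.
have realD := hermitian_spectral_diag_real hermS.
set P := spectralmx SC in defSC; set d := spectral_diag SC in defSC realD.
have uP : P \in unitmx by exact: spectral_unit.
suff d0 : d = 0.
  apply: (@map_mx_inj _ _ (real_complex R)).
  by rewrite -/SC defSC d0 linear0 mulmx0 mul0mx map_mx0.
apply/rowP => i; rewrite [RHS]mxE.
have /complex_realP[k dk] : d 0 i \is Num.real by exact: (mxOverP realD).
rewrite dk; have [-> //|k0] := eqVneq k 0.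
pose t := - k^-1.
have : map_mx (real_complex R) (1%:M + t *: S) \in unitmx.
  by rewrite map_unitmx.
have -> : map_mx (real_complex R) (1%:M + t *: S) =
    invmx P *m (1%:M + (real_complex R t) *: diag_mx d) *m P.
  rewrite mulmxDr mulmxDl mulmx1 mulVmx // -scalemxAr -scalemxAl -defSC.
  by rewrite map_mxD map_mx1 map_mxZ.
rewrite !unitmx_mul unitmx_inv uP /= andbT unitmxE.
rewrite -(diag_const_mx) -linearZ -linearD det_diag unitfE.
rewrite (bigD1 i) //= !mxE dk.
by rewrite -rmorphM mulNr mulVf // rmorphN1 subrr mul0r eqxx.
Qed.

Lemma gram_eq0 (R : realDomainType) m n (Z : 'M[R]_(m, n)) :
  Z *m Z^T = 0 -> Z = 0.
Proof.
move=> ZZ; apply/matrixP => i j; rewrite [RHS]mxE.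
move/matrixP/(_ i i)/eqP: ZZ; rewrite !mxE psumr_eq0 => [|k _]; last first.
  by rewrite mxE -expr2 sqr_ge0.
by move/allP/(_ j (mem_index_enum _)); rewrite mxE -expr2 sqrf_eq0 => /eqP.
Qed.

(** The rank bound from above kills [V] and [Z Z^T]; the bound from below then
    makes [1 + t S] invertible for every [t]. *)
Lemma block_pencil_eq0 (R : rcfType) r p q (S : 'M[R]_r)
    (Z : 'M[R]_(p, r)) (V : 'M[R]_(p, p + q)) :
  S^T = S ->
  (forall t, \rank (pid_mx r + t *: block_mx S (row_mx Z^T 0) Z V)%R = r) ->
  block_mx S (row_mx Z^T 0) Z V = 0.
Proof.
move=> symS rk.
have pencil t : pid_mx r + t *: block_mx S (row_mx Z^T 0) Z V =
    block_mx (1%:M + t *: S) (t *: row_mx Z^T 0) (t *: Z) (t *: V).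
  by rewrite pid_mx_block scale_block_mx add_block_mx !add0r.
have [|V0] := @rank_pencil_corner _ _ _ _ S (row_mx Z^T 0) Z V.
  by move=> t; rewrite -pencil rk.
rewrite mul_mx_row mulmx0 -[X in _ = X -> _]row_mx0.
case/eq_row_mx => /gram_eq0 Z0 _.
suff S0 : S = 0 by rewrite S0 V0 Z0 trmx0 row_mx0 block_mx0.
apply: symmetric_pencil_unit_eq0 => // t; move: (rk t).
rewrite pencil V0 Z0 trmx0 row_mx0 !scaler0 rank_diag_block_mx mxrank0 addn0.
by move=> rkS; rewrite -row_free_unit /row_free rkS.
Qed.

(** * The positions above the diagonal in the first r rows *)

(** This type indexes both the coordinates that determine a direction in the
    upper bound and the free entries of the extremal subspace. *)
Definition above_diag m n r :=
  {ij : 'I_m * 'I_n | (ij.1 < r)%N && (ij.1 < ij.2)%N}.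

Lemma sum_row_lengths r n : (r <= n)%N ->
  (\sum_(i < r) (n - i.+1) = r * n - (r * r.+1) %/ 2)%N.
Proof.
move=> rn.
(* Doubling removes the division. *)
have E : ((\sum_(i < r) (n - i.+1)) * 2 + r * r.+1 = r * n * 2)%N.
  elim: r rn => [|r IHr] rn; first by rewrite big_ord0.
  rewrite big_ord_recr /=; move: (IHr (ltnW rn)).
  move: (\sum_(i < r) _)%N => u; rewrite -(subnK rn) addnK; nia.
by rewrite -[X in (X - _)%N](mulnK _ (isT : 0 < 2)%N) -E divnMDl // addnK.
Qed.

Lemma card_above_diag m n r : (r <= m)%N -> (m <= n)%N ->
  #|{: above_diag m n r}| = (r * n - (r * r.+1) %/ 2)%N.
Proof.
move=> rm mn; rewrite card_sig -sum1_card -sum_row_lengths ?(leq_trans rm) //.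
rewrite (eq_bigl (fun ij : 'I_m * 'I_n => (ij.1 < r) && (ij.1 < ij.2))%N) //.
rewrite -(pair_big_dep (fun i : 'I_m => i < r)%N
                       (fun (i : 'I_m) (j : 'I_n) => i < j)%N (fun _ _ => 1%N)).
rewrite (big_ord_widen m (fun i => n - i.+1)%N rm); apply: eq_bigr => i _.
rewrite -(big_geq_mkord _ _ predT (fun _ => 1%N)) sum_nat_const_nat muln1.
by [].
Qed.

Lemma dim_ffun_above_diag (F : fieldType) m n r :
  (r <= m)%N -> (m <= n)%N ->
  \dim {: {ffun above_diag m n r -> F^o}} = (r * n - (r * r.+1) %/ 2)%N.
Proof.
move=> rm mn; rewrite dimvf -(card_above_diag rm mn).
by rewrite -[LHS]/(_ * 1)%N muln1.
Qed.

(** * The upper bound *)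

(** For a column index [j] that is not a row index, [insub] fails and the
    transposed entry is replaced by [0]. *)
Definition sym_defect (F : fieldType) m n r (hmn : (m <= n)%N)
    (B : 'M[F]_(m, n)) : {ffun above_diag m n r -> F^o} :=
  [ffun k => B (val k).1 (val k).2 -
     oapp (fun j => B j (widen_ord hmn (val k).1)) 0 (insub (val (val k).2))].

Lemma sym_defect_is_linear (F : fieldType) m n r (hmn : (m <= n)%N) :
  linear (@sym_defect F m n r hmn).
Proof.
move=> a B C; apply/ffunP => k; rewrite !ffunE !mxE.
by case: insubP => [j _ _|_] /=; rewrite ?mxE /GRing.scale /=; ring.
Qed.

HB.instance Definition _ (F : fieldType) m n r (hmn : (m <= n)%N) :=
  GRing.isLinear.Build F _ _ _ _ (@sym_defect_is_linear F m n r hmn).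

Lemma sym_defect_pencil_eq0 (R : rcfType) m n r (hmn : (m <= n)%N)
    (B : 'M[R]_(m, n)) : (r <= m)%N ->
  (forall t, \rank (pid_mx r + t *: B)%R = r) ->
  sym_defect r hmn B = 0 -> B = 0.
Proof.
move=> /subnKC; move: (m - r)%N => p mE; case: m / mE hmn B => hmn.
have : (r + p + (n - (r + p)) = n)%N by rewrite subnKC.
rewrite -addnA; move: (n - _)%N => q nE; case: n / nE hmn => hmn B rk.
move=> defect0.
have defectE (i : 'I_(r + p)) (j : 'I_(r + (p + q))) :
    (i < r)%N -> (i < j)%N ->
    B i j = oapp (fun j => B j (widen_ord hmn i)) 0 (insub (val j)).
  move=> ir ij; have Kij : ((i, j).1 < r)%N && ((i, j).1 < (i, j).2)%N.
    by rewrite ir ij.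
  move/ffunP/(_ (exist _ (i, j) Kij)): defect0.
  by rewrite !ffunE /= => /subr0_eq.
have symB (i j : 'I_r) : (i < j)%N ->
    B (lshift p i) (lshift (p + q) j) = B (lshift p j) (lshift (p + q) i).
  move=> ij; rewrite defectE //=.
  have -> : insub (j : nat) = Some (lshift p j).
    by rewrite insubT ?ltn_addr // => ?; congr Some; apply: val_inj.
  by congr (B _ _); apply: val_inj.
have urB : ursubmx B = row_mx (dlsubmx B)^T 0.
  apply/matrixP => i j; rewrite 2!mxE defectE /=; [|by []|]; last first.
    exact: ltn_addr.
  case: (split_ordP j) => k ->.
    rewrite row_mxEl !mxE /=.
    have rk_lt : (r + k < r + p)%N by rewrite ltn_add2l.
    rewrite (insubT (fun x => x < r + p)%N rk_lt) /=.
    by congr (B _ _); apply: val_inj.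
  by rewrite row_mxEr mxE insubF //= ltn_add2l ltnNge leq_addr.
move: rk; rewrite -[B]submxK urB; apply: block_pencil_eq0.
apply/matrixP => i j; rewrite !mxE.
case: (ltngtP i j) => [/symB->//|/symB->//|/ord_inj->//].
Qed.

(** Gaussian elimination writes [A] as [col_ebase A *m pid_mx r *m row_ebase A];
    cancelling the outer factors makes [sym_defect] injective on [W]. *)
Lemma dim_constant_rank_le (R : rcfType) m n r (A : 'M[R]_(m, n))
    (W : {vspace 'M[R]_(m, n)}) : (r <= m)%N -> (m <= n)%N ->
  (forall B, B \in W -> \rank (A + B)%R = r) ->
  (\dim W <= r * n - (r * r.+1) %/ 2)%N.
Proof.
move=> rm mn rk.
have rkA : \rank A = r by rewrite -[A]addr0 rk ?mem0v.
pose P := invmx (col_ebase A); pose Q := invmx (row_ebase A).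
pose phi B := sym_defect r mn (P *m B *m Q).
have lin_phi : linear phi.
  move=> a B C; rewrite /phi mulmxDr mulmxDl -scalemxAr -scalemxAl.
  exact: linearP.
pose phiL := GRing.isLinear.Build R _ _ _ phi lin_phi.
pose phiH : {linear _ -> _} := HB.pack phi phiL.
rewrite -(dim_ffun_above_diag R rm mn) -(@limg_dim_eq _ _ _ (linfun phiH)).
  exact/dimvS/subvf.
apply/eqP; rewrite -subv0; apply/subvP => B /memv_capP[BW].
rewrite memv_ker lfunE /= memv0 => /eqP phiB.
have [uL uR] := (col_ebase_unit A, row_ebase_unit A).
suff PBQ0 : P *m B *m Q = 0.
  by rewrite -(mulKVmx uL B) -/P -(mulmxKV uR (P *m B)) -/Q PBQ0 mul0mx mulmx0.
apply: sym_defect_pencil_eq0 phiB => // t.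
rewrite -[RHS](rk (t *: B)) ?memvZ //.
have -> : (A + t *: B)%R =
    col_ebase A *m (pid_mx r + t *: (P *m B *m Q)) *m row_ebase A.
  rewrite mulmxDr mulmxDl -{1}rkA mulmx_ebase -scalemxAr -scalemxAl.
  by rewrite !mulmxA mulmxKV // mulmxV // mul1mx.
by rewrite mxrankMfree ?row_free_unit // eqmxMfull ?row_full_unit.
Qed.

(** * The lower bound *)

(** The leading [r x r] block is upper triangular with unit diagonal, and the
    remaining rows are zero. *)
Lemma rank_unit_echelon (F : fieldType) m n r (M : 'M[F]_(m, n)) :
  (r <= m)%N -> (r <= n)%N ->
  (forall (i : 'I_m) j, (r <= i)%N -> M i j = 0) ->
  (forall (i : 'I_m) (j : 'I_n), (j < i)%N -> M i j = 0) ->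
  (forall (i : 'I_m) (j : 'I_n), (i < r)%N -> i = j :> nat -> M i j = 1) ->
  \rank M = r.
Proof.
move=> /subnKC; move: (m - r)%N => p mE; case: m / mE M => M.
move=> /subnKC; move: (n - r)%N => q nE; case: n / nE M => M low0 sub0 diag1.
have dM : dsubmx M = 0.
  by apply/matrixP => i j; rewrite !mxE low0 //= leq_addr.
rewrite -[M]vsubmxK dM -addsmxE addsmx0; apply/eqP.
rewrite eqn_leq rank_leq_row /=.
have uU : lsubmx (usubmx M) \in unitmx.
  rewrite unitmxE -det_tr det_trig.
    by rewrite big1 ?unitr1 // => i _; rewrite !mxE diag1 /= ?ltn_ord.
  by apply/is_trig_mxP => i j ij; rewrite !mxE sub0.
have defU : lsubmx (usubmx M) = usubmx M *m col_mx 1%:M 0.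
  by rewrite -{2}[usubmx M]hsubmxK mul_row_col mulmx1 mulmx0 addr0.
by rewrite -{1}(mxrank_unit uU) defU mxrankM_maxl.
Qed.

Definition above_diag_mx (F : fieldType) m n r
    (f : {ffun above_diag m n r -> F^o}) : 'M[F]_(m, n) :=
  \matrix_(i, j) oapp f 0 (insub (i, j)).

Lemma above_diag_mx_is_linear (F : fieldType) m n r :
  linear (@above_diag_mx F m n r).
Proof.
move=> a f g; apply/matrixP => i j; rewrite !mxE.
by case: insubP => [k _ _|_] /=; rewrite ?ffunE ?mulr0 ?addr0.
Qed.

HB.instance Definition _ (F : fieldType) m n r :=
  GRing.isLinear.Build F _ _ _ _ (@above_diag_mx_is_linear F m n r).

Lemma above_diag_mx_inj (F : fieldType) m n r :
  injective (@above_diag_mx F m n r).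
Proof.
move=> f g /matrixP fg; apply/ffunP => k.
by have := fg (val k).1 (val k).2; rewrite !mxE -surjective_pairing valK.
Qed.

Lemma rank_above_diag (F : fieldType) m n r f : (r <= m)%N -> (m <= n)%N ->
  \rank (pid_mx r + @above_diag_mx F m n r f)%R = r.
Proof.
move=> rm mn; apply: rank_unit_echelon => //; first exact: leq_trans mn.
- move=> i j ri; rewrite !mxE ltnNge ri andbF add0r.
  by rewrite insubF //= ltnNge ri.
- move=> i j ji; rewrite !mxE gtn_eqF //= add0r.
  by rewrite insubF //= [(i < j)%N]ltnNge (ltnW ji) andbF.
- move=> i j ir ij; rewrite !mxE ij eqxx -ij ir insubF ?addr0 //=.
  by rewrite ij ltnn andbF.
Qed.
(** * The maximal dimension *)

(* For r <= n the natural subtraction does not truncate, and r (r + 1) is even,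
   so the division is exact. *)
Theorem theorem5 (R : realType) (m n r : nat) (hrm : (r <= m)%N)
    (hmn : (m <= n)%N) :
  max_affine_dim_constant_rank R m n r (r * n - (r * r.+1) %/ 2)%N.
Proof.
split=> [|d [S [[A [W [-> ->]]] rkS]]]; last first.
  by apply: dim_constant_rank_le => // B BW; apply: rkS; exists B.
pose f := linfun (@above_diag_mx R m n r).
exists [set pid_mx r + B | B in [set` limg f]]%classic; split.
  exists (pid_mx r), (limg f); split=> //.
  rewrite limg_dim_eq ?dim_ffun_above_diag // capfv.
  by apply/eqP/lker0P => g h; rewrite !lfunE => /above_diag_mx_inj.
by move=> _ [_ /memv_imgP[g _ ->] <-]; rewrite lfunE rank_above_diag.
Qed.
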